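(* Let $\langle\mathcal{A},\mathcal{R}\rangle$ be an AFRA, $\mathcal{S}\subseteq\mathcal{A}\cup\mathcal{R}$ an admissible set and $V,V'\in\mathcal{A}\cup\mathcal{R}$ elements acceptable w.r.t. $\mathcal{S}$. Then: 1. $\mathcal{S}'=\mathcal{S}\cup\{V\}$ is admissible; and 2. $V'$ is acceptable w.r.t. $\mathcal{S}'$.
   Context: An AFRA (Argumentation Framework with Recursive Attacks) is a pair $\langle\mathcal{A},\mathcal{R}\rangle$ where $\mathcal{A}$ is a set (of arguments) and $\mathcal{R}$ is a set of attacks, each attack being a pair $\alpha=(A,X)$ with $A\in\mathcal{A}$ and ($X\in\mathcal{R}$ or $X\in\mathcal{A}$); $A=src(\alpha)$ is its source and $X=trg(\alpha)$ its target. Arguments and attacks are distinct objects ($\mathcal{A}\cap\mathcal{R}=\emptyset$). Defeat: for $\alpha\in\mathcal{R}$, $V\in\mathcal{A}\cup\mathcal{R}$, $\alpha$ directly defeats $V$ iff $V=trg(\alpha)$; $\alpha$ indirectly defeats $\beta\in\mathcal{R}$ iff $\alpha$ directly defeats $src(\beta)$; $\alpha\rightarrow_R V$ ($\alpha$ defeats $V$) iff $\alpha$ directly or indirectly defeats $V$. Only attacks can defeat. A set $\mathcal{S}\subseteq\mathcal{A}\cup\mathcal{R}$ is conflict-free iff there are no $V,W\in\mathcal{S}$ with $V\rightarrow_R W$. $W\in\mathcal{A}\cup\mathcal{R}$ is acceptable w.r.t. $\mathcal{S}$ iff for every $\alpha\in\mathcal{R}$ with $\alpha\rightarrow_R W$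 there is $\beta\in\mathcal{S}$ with $\beta\rightarrow_R\alpha$. $\mathcal{S}$ is admissible iff it is conflict-free and each of its elements is acceptable w.r.t. $\mathcal{S}$. *)

(* Defs.v *)
From mathcomp Require Import all_boot.
From mathcomp Require Import boolp classical_sets.

Set Implicit Arguments.
Unset Strict Implicit.
Unset Printing Implicit Defensive.

Local Open Scope classical_set_scope.

(* The set of arguments and the set of attacks are two (possibly infinite)
   types, hence disjoint. Each attack is a pair of a source and a target:
   [ends] reads off that pair, and its injectivity says that an attack is
   nothing more than the pair. *)
Record afra := Afra {
  argument : Type;
  attack : Type;
  ends : attack -> argument * (argument + attack);
  ends_inj : injective ends }.

Definition element (G : afra) : Type := (argument G + attack G)%type.

Definition src (G : afra) (a : attack G) : argument G := (ends a).1.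

Definition trg (G : afra) (a : attack G) : element G := (ends a).2.

Definition directly_defeats (G : afra) (a : attack G) (V : element G) : Prop :=
  V = trg a.

Definition indirectly_defeats (G : afra) (a b : attack G) : Prop :=
  directly_defeats a (inl (src b)).

Definition defeats (G : afra) (a : attack G) (V : element G) : Prop :=
  directly_defeats a V \/ exists2 b, V = inr b & indirectly_defeats a b.

(* Only attacks can defeat, so the defeating member ranges over attacks. *)
Definition conflict_free (G : afra) (S : set (element G)) : Prop :=
  ~ exists (a : attack G) (W : element G), [/\ S (inr a), S W & defeats a W].

Definition acceptable (G : afra) (S : set (element G)) (W : element G) : Prop :=
  forall a : attack G, defeats a W ->
    exists2 b : attack G, S (inr b) & defeats b (inr a).

Definition admissible (G : afra) (S : set (element G)) : Prop :=
  conflict_free S /\ forall W, S W -> acceptable S W.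

(* Main.v *)
Require Import Defs.
From mathcomp Require Import all_boot.
From mathcomp Require Import boolp classical_sets.

Local Open Scope classical_set_scope.

(** Adding [V] to [S] yields only elements acceptable w.r.t. the old [S]. Among these no attack
    defeats another element, by [acceptable_not_defeats], so the union is conflict-free; the rest is
    monotonicity of acceptability in the set. *)

(* If an acceptable attack [a] defeats an acceptable [W], then [S] defeats [a]
   to defend [W], and defeats that defender to defend [a]: a conflict in [S]. *)
Lemma acceptable_not_defeats (G : afra) (S : set (element G)) (a : attack G)
    (W : element G) :
  conflict_free S -> acceptable S (inr a) -> acceptable S W -> ~ defeats a W.
Proof.
move=> cfS acca accW /accW[b Sb /acca[c Sc cb]].
by apply: cfS; exists c, (inr b).
Qed.

Lemma acceptable_subset (G : afra) (S T : set (element G)) (W : element G) :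
  S `<=` T -> acceptable S W -> acceptable T W.
Proof. by move=> ST accW a /accW[b /ST Tb ba]; exists b. Qed.

Theorem lemma2 (G : afra) (S : set (element G)) (V V' : element G)
    (admS : admissible S) (accV : acceptable S V) (accV' : acceptable S V') :
  admissible (S `|` [set V]) /\ acceptable (S `|` [set V]) V'.
Proof.
have [cfS accS] := admS.
have acc W : (S `|` [set V]) W -> acceptable S W by case=> [/accS|->].
have SSV : S `<=` S `|` [set V] by move=> W; left.
split; last exact: acceptable_subset accV'.
split; last by move=> W /acc; exact: acceptable_subset.
(* No case split on which of [inr a] and [W] equals [V]: both are acceptable w.r.t. [S], so
   self-defeat of [V] is covered too. *)
move=> [a [W [/acc acca /acc accW]]].
exact: acceptable_not_defeats accW.
Qed.
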